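(* Let $I\subset K[x_1,\ldots,x_n]$ be an ideal of dimension $m$ generated by linear forms. Then $\mathrm{gT}(I)=\mathcal{W}_n^m$ as fans.
   Context: $K$ is an algebraically closed field of characteristic $0$ with trivial valuation; $\dim I$ is the Krull dimension of $K[x_1,\ldots,x_n]/I$. Each $g=(g_{ij})\in\mathrm{GL}_n(K)$ acts by $x_i\mapsto\sum_j g_{ij}x_j$; $\mathrm{GL}_n(K)$ has the Zariski topology. For $f=\sum_\nu a_\nu x^\nu$ and $\omega\in\mathbb{R}^n$, $\mathrm{in}_\omega(f)$ is the sum of the terms with $\omega\cdot\nu$ minimal; $\mathrm{in}_\omega(I)$ is generated by the $\mathrm{in}_\omega(f)$, $f\in I$. The Gröbner fan has as relatively open cones the classes of $\omega\sim\omega'\iff\mathrm{in}_\omega(I)=\mathrm{in}_{\omega'}(I)$; $T(I)=\{\omega:\mathrm{in}_\omega(f)\text{ is not a monomial for every }f\in I\}$ is the subfan of cones whose initial ideal contains no monomial; $\mathrm{gT}(I)$ is the fan equal to $T(g(I))$ for all $g$ in a non-empty Zariski-open subset of $\mathrm{GL}_n(K)$. The generic tropical fan $\mathcal{W}_n$ consists of the cones $C_A=\{\omega:\omega_i=\min_k\omega_k\text{ for all }i\in A\}$ for nonempty $A\subset\{1,\ldots,n\}$ ($\dim C_A=n-|A|+1$), and $\mathcal{W}_n^m$ is its subfan of cones of dimension at most $m$.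
   Formalization: The ideal I is assumed to be nonzero: for I = 0 and n ≥ 2 the Gröbner fan is the single cone R^n, while W_n^n has 2^n − 1 cones, so the equality as fans fails there. *)

(* Defs.v *)
From HB Require Import structures.
From mathcomp Require Import all_boot all_order all_algebra.
From mathcomp Require Import reals.
From mathcomp Require Import mpoly.

Set Implicit Arguments.
Unset Strict Implicit.
Unset Printing Implicit Defensive.

Import Order.TTheory GRing.Theory Num.Theory.
Local Open Scope ring_scope.

Section Defs.
Variables (K : fieldType) (n : nat).

Notation poly := {mpoly K[n]}.

Definition is_ideal (I : poly -> Prop) : Prop :=
  [/\ I 0, (forall f g, I f -> I g -> I (f + g)) & (forall r f, I f -> I (r * f))].

Definition ideal_eq (I J : poly -> Prop) : Prop := forall f, I f <-> J f.

Definition ideal_gen (S : poly -> Prop) : poly -> Prop :=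
  fun h => exists (s cs : seq poly),
    [/\ size cs = size s, (forall i, (i < size s)%N -> S (nth 0 s i))
      & h = \sum_(i < size s) nth 0 cs i * nth 0 s i].

Definition linear_form (l : poly) : Prop :=
  exists c : 'I_n -> K, l = \sum_(j < n) c j *: 'X_j.

Definition gen_by_linear_forms (I : poly -> Prop) : Prop :=
  exists s : seq poly, (forall l, l \in s -> linear_form l) /\
    ideal_eq I (ideal_gen (fun f => f \in s)).

Definition prime_ideal (P : poly -> Prop) : Prop :=
  [/\ is_ideal P, ~ P 1 & (forall f g, P (f * g) -> P f \/ P g)].

Definition prime_chain (I : poly -> Prop) (k : nat) : Prop :=
  exists P : nat -> poly -> Prop,
    [/\ (forall i, (i <= k)%N -> prime_ideal (P i)),
        (forall f, I f -> P 0%N f),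
        (forall i, (i < k)%N -> forall f, P i f -> P i.+1 f)
      & (forall i, (i < k)%N -> exists f, P i.+1 f /\ ~ P i f)].

Definition krull_dim_quot (I : poly -> Prop) (m : nat) : Prop :=
  prime_chain I m /\ ~ prime_chain I m.+1.

Definition gact (g : 'M[K]_n) (f : poly) : poly :=
  f \mPo [tuple \sum_(j < n) g i j *: 'X_j | i < n].

Definition gideal (g : 'M[K]_n) (I : poly -> Prop) : poly -> Prop :=
  fun h => exists f, I f /\ h = gact g f.

Definition zariski_open_GL (U : 'M[K]_n -> Prop) : Prop :=
  (forall g, U g -> g \in unitmx) /\
  exists S : {mpoly K[n * n]} -> Prop,
    forall g, g \in unitmx ->
      (U g <-> exists h, S h /\ h.@[fun k => mxvec g 0 k] != 0).

Variable R : realType.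

Definition wdeg (w : 'I_n -> R) (m : 'X_{1..n}) : R :=
  \sum_(i < n) w i * (m i)%:R.

Definition init_form (w : 'I_n -> R) (f : poly) : poly :=
  \sum_(m <- msupp f | all (fun m' => wdeg w m <= wdeg w m') (msupp f))
     f@_m *: 'X_[m].

Definition init_ideal (w : 'I_n -> R) (I : poly -> Prop) : poly -> Prop :=
  ideal_gen (fun h => exists f, I f /\ h = init_form w f).

Definition is_monomial (p : poly) : Prop :=
  exists (c : K) (m : 'X_{1..n}), c != 0 /\ p = c *: 'X_[m].

Definition trop (I : poly -> Prop) (w : 'I_n -> R) : Prop :=
  forall f, I f -> ~ is_monomial (init_form w f).

Definition groeb_equiv (I : poly -> Prop) (w w' : 'I_n -> R) : Prop :=
  ideal_eq (init_ideal w I) (init_ideal w' I).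

(* the (relatively open) cones of the fan T(I): the Groebner-fan classes
   of points of T(I) *)
Definition trop_cell (I : poly -> Prop) (C : ('I_n -> R) -> Prop) : Prop :=
  exists w, trop I w /\ forall w', C w' <-> groeb_equiv I w w'.

Definition is_min (w : 'I_n -> R) (i : 'I_n) : Prop := forall k, w i <= w k.

Definition cone_W (A : {set 'I_n}) (w : 'I_n -> R) : Prop :=
  forall i, i \in A -> is_min w i.

(* relative interior of C_A: C_A minus its proper faces C_B, B strictly
   containing A, i.e. the minimum is attained exactly on A *)
Definition open_cone_W (A : {set 'I_n}) (w : 'I_n -> R) : Prop :=
  cone_W A w /\ forall i, i \notin A -> ~ is_min w i.

(* cells of W_n^m: relative interiors of the C_A, A nonempty,
   dim C_A = n - |A| + 1 <= m *)
Definition Wnm_cell (m : nat) (C : ('I_n -> R) -> Prop) : Prop :=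
  exists A : {set 'I_n}, [/\ A != set0, (n.+1 <= m + #|A|)%N
    & forall w, C w <-> open_cone_W A w].

(* equality of fans, via their sets of relatively open cones *)
Definition fan_eq (F G : (('I_n -> R) -> Prop) -> Prop) : Prop :=
  forall C, F C <-> G C.

Definition generic_trop_is (I : poly -> Prop)
    (F : (('I_n -> R) -> Prop) -> Prop) : Prop :=
  exists U : 'M[K]_n -> Prop,
    [/\ zariski_open_GL U, (exists g, U g)
      & forall g, U g -> fan_eq (trop_cell (gideal g I)) F].

End Defs.

(* Main.v *)
(* After a general change of coordinates the linear forms of I make up the row
   space L of a d x n matrix all of whose d x d minors are nonzero (generic
   coordinates exist by Vandermonde); d = n - m.  Let A be the set where w is
   minimal.
   If |A| <= d, some element of L is x_i plus terms outside A with i in A, so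
   its initial form is the monomial x_i.
   If |A| > d, pick d indices D inside A; modulo L every x_i with i in D is a
   linear form P(x_i) in the x_j with j outside D.  Since w is minimal on D,
   P(x_i) has weight at least w_i, and dropping its terms outside A leaves its
   part P'(x_i) of weight exactly w_i.  Comparing terms of lowest weight, P f = 0
   implies P' (in_w f) = 0, so in_w(I) is the kernel of the substitution P',
   which depends on w only through A, contains no monomial, and determines A.
   The dimension is read off from a count: a chain of j + 1 primes of
   K[y_1..y_k] yields t^j independent polynomials of degree O(t), while there
   are only O(t^k) monomials of that degree. *)
Require Import Defs.
From HB Require Import structures.
From mathcomp Require Import all_boot all_order all_algebra.
From mathcomp Require Import reals.
From mathcomp Require Import mpoly.
Local Open Scope ring_scope.

Set Implicit Arguments.
Unset Strict Implicit.
Unset Printing Implicit Defensive.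
Import Order.TTheory GRing.Theory Num.Theory.

(** * Ideals and linear substitutions *)

Section Ideals.
Variables (K : fieldType) (n : nat).
Notation poly := {mpoly K[n]}.
Implicit Types (I J S : poly -> Prop) (f : poly).

Lemma ideal_sum J (T : Type) (r : seq T) (Q : pred T) (F : T -> poly) :
  is_ideal J -> (forall i, Q i -> J (F i)) -> J (\sum_(i <- r | Q i) F i).
Proof. by case=> J0 JD _ JF; apply: big_ind => // *; apply: JD. Qed.

Lemma ideal_opp J f : is_ideal J -> J f -> J (- f).
Proof. by case=> _ _ JM Jf; rewrite -mulN1r; apply: JM. Qed.

Lemma ideal_sub J f g : is_ideal J -> J f -> J g -> J (f - g).
Proof. by move=> idJ Jf Jg; case: (idJ) => _ JD _; apply: JD => //; apply: ideal_opp. Qed.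

Lemma ideal_scale J (c : K) f : is_ideal J -> J f -> J (c *: f).
Proof. by case=> _ _ JM Jf; rewrite -mul_mpolyC; apply: JM. Qed.

Lemma ideal_gen_mem S f : S f -> ideal_gen S f.
Proof.
move=> Sf; exists [:: f], [:: 1]; split=> //; first by case.
by rewrite big_ord1 /= mul1r.
Qed.

Lemma ideal_gen_ideal S : is_ideal (ideal_gen S).
Proof.
split.
- by exists [::], [::]; split=> //; rewrite big_ord0.
- move=> f g [s [cs [szs sS ->]]] [s' [cs' [szs' sS' ->]]].
  exists (s ++ s'), (cs ++ cs'); split.
  + by rewrite !size_cat szs szs'.
  + move=> i; rewrite size_cat nth_cat; case: (ltnP i (size s)) => [lt_i _|le_i lt_i].
      exact: sS.
    by apply: sS'; rewrite ltn_subLR.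
  + rewrite size_cat big_split_ord /=; congr (_ + _); apply: eq_bigr => i _.
      by rewrite !nth_cat szs ltn_ord.
    by rewrite !nth_cat szs !ltnNge !leq_addr /= !addKn.
- move=> r f [s [cs [szs sS ->]]]; exists s, (map (fun c => r * c) cs).
  split; rewrite ?size_map // mulr_sumr; apply: eq_bigr => i _.
  by rewrite (nth_map 0) ?szs // mulrA.
Qed.

Lemma ideal_gen_min S J f :
  is_ideal J -> (forall g, S g -> J g) -> ideal_gen S f -> J f.
Proof.
move=> idJ SJ [s [cs [_ sS ->]]]; apply: ideal_sum => // i _.
by case: idJ => _ _ JM; apply: JM; apply: SJ; apply: sS.
Qed.

Lemma mpoly_ring_ind (Q : poly -> Prop) :
    (forall c, Q c%:MP) -> (forall i, Q 'X_i) ->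
    (forall f g, Q f -> Q g -> Q (f + g)) ->
    (forall f g, Q f -> Q g -> Q (f * g)) ->
  forall f, Q f.
Proof.
move=> QC QX QD QM f; rewrite (mpolyE f).
apply: (big_ind Q) => // [|m _]; first by rewrite -mpolyC0.
rewrite -mul_mpolyC; apply: (QM) => //.
rewrite mpolyXE_id; apply: (big_ind Q) => // [|i _]; first by rewrite -mpolyC1.
elim: (m i) => [|k IHk]; first by rewrite expr0 -mpolyC1.
by rewrite exprS; apply: QM.
Qed.

End Ideals.

Section LinSubst.
Variable K : fieldType.

Definition lform n (v : 'rV[K]_n) : {mpoly K[n]} := \sum_(j < n) v 0 j *: 'X_j.

(** Rectangular matrices are allowed, so that coordinate changes, parametrizations and truncations
    are all of this form and compose by matrix product. *)
Definition lin_subst p q (M : 'M[K]_(p, q)) (f : {mpoly K[p]}) : {mpoly K[q]} :=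
  f \mPo [tuple lform (row i M) | i < p].

Lemma lform_is_linear n : linear (@lform n).
Proof.
move=> a u v; rewrite /lform scaler_sumr -big_split /=.
by apply: eq_bigr => j _; rewrite !mxE scalerDl scalerA.
Qed.
HB.instance Definition _ n := GRing.isLinear.Build K 'rV[K]_n {mpoly K[n]} _
  (@lform n) (@lform_is_linear n).

HB.instance Definition _ p q (M : 'M[K]_(p, q)) :=
  GRing.RMorphism.copy (lin_subst M) (lin_subst M).
HB.instance Definition _ p q (M : 'M[K]_(p, q)) :=
  GRing.Linear.copy (lin_subst M) (lin_subst M).

Lemma gactE n (g : 'M[K]_n) f : gact g f = lin_subst g f.
Proof.
congr (f \mPo _); apply: eq_from_tnth => i; rewrite !tnth_mktuple.
by apply: eq_bigr => j _; rewrite mxE.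
Qed.

Lemma lin_substC p q (M : 'M[K]_(p, q)) c : lin_subst M c%:MP = c%:MP.
Proof. exact: comp_mpolyC. Qed.

Lemma lin_substXU p q (M : 'M[K]_(p, q)) i : lin_subst M 'X_i = lform (row i M).
Proof. by rewrite /lin_subst comp_mpolyXU -tnth_nth tnth_mktuple. Qed.

Lemma lin_substXm p q (M : 'M[K]_(p, q)) m :
  lin_subst M 'X_[m] = \prod_(i < p) lform (row i M) ^+ m i.
Proof.
by rewrite /lin_subst comp_mpolyX; apply: eq_bigr => i _; rewrite tnth_mktuple.
Qed.

Lemma lin_substE p q (M : 'M[K]_(p, q)) f :
  lin_subst M f = \sum_(m <- msupp f) f@_m *: lin_subst M 'X_[m].
Proof. exact: comp_mpolyEX. Qed.

Lemma lin_subst_lform p q (M : 'M[K]_(p, q)) v :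
  lin_subst M (lform v) = lform (v *m M).
Proof.
rewrite /lform linear_sum mulmx_sum_row /=.
rewrite -[RHS]/(lform _) linear_sum; apply: eq_bigr => i _.
by rewrite linearZ /= lin_substXU linearZ.
Qed.

Lemma lin_subst_comp p q r (M : 'M[K]_(p, q)) (N : 'M[K]_(q, r)) f :
  lin_subst N (lin_subst M f) = lin_subst (M *m N) f.
Proof.
elim/mpoly_ring_ind: f => [c|i|f g IHf IHg|f g IHf IHg].
- by rewrite !lin_substC.
- by rewrite !lin_substXU lin_subst_lform row_mul.
- by rewrite !rmorphD /= IHf IHg.
- by rewrite !rmorphM /= IHf IHg.
Qed.

Lemma lformX n i : lform (row i 1%:M) = 'X_i :> {mpoly K[n]}.
Proof.
rewrite /lform (bigD1 i) //= !mxE eqxx scale1r big1 ?addr0 // => j ji.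
by rewrite !mxE eq_sym (negbTE ji) scale0r.
Qed.

Lemma lin_subst1 n f : lin_subst 1%:M f = f :> {mpoly K[n]}.
Proof.
elim/mpoly_ring_ind: f => [c|i|f g IHf IHg|f g IHf IHg].
- exact: lin_substC.
- by rewrite lin_substXU lformX.
- by rewrite rmorphD /= IHf IHg.
- by rewrite rmorphM /= IHf IHg.
Qed.

(** A substitution is a ring morphism, so its congruence with the identity modulo an ideal need only
    be checked on the variables. *)
Lemma sub_lin_subst_ideal n (J : {mpoly K[n]} -> Prop) (M : 'M[K]_n) f :
    is_ideal J -> (forall i, J (lform (row i (1%:M - M)))) ->
  J (f - lin_subst M f).
Proof.
move=> idJ JX; case: (idJ) => J0 JD JM.
elim/mpoly_ring_ind: f => [c|i|f g Jf Jg|f g Jf Jg].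
- by rewrite lin_substC subrr.
- by rewrite lin_substXU -lformX -linearB -(linearB (row i)); apply: JX.
- by rewrite rmorphD /= opprD addrACA; apply: JD.
- rewrite rmorphM /=.
  have -> : f * g - lin_subst M f * lin_subst M g =
    g * (f - lin_subst M f) + lin_subst M f * (g - lin_subst M g).
    by rewrite !mulrBr addrA [g * f]mulrC [g * _]mulrC subrK.
  by apply: JD; apply: JM.
Qed.

Lemma lform_mcoeffU n (v : 'rV[K]_n) j : (lform v)@_U_(j) = v 0 j.
Proof.
rewrite /lform linear_sum (bigD1 j) //= mcoeffZ mcoeffXU eqxx mulr1.
by rewrite big1 ?addr0 // => i ij; rewrite mcoeffZ mcoeffXU (negbTE ij) mulr0.
Qed.

Lemma lform_mcoeff_neq0 n (v : 'rV[K]_n) m :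
  (lform v)@_m != 0 -> exists j, m = U_(j)%MM.
Proof.
have [/eqP/mdeg1P[j /eqP ->]|m1] := eqVneq (mdeg m) 1%N; first by exists j.
rewrite /lform linear_sum big1 ?eqxx // => i _ /=.
rewrite mcoeffZ mcoeffX; case: eqP => [im|]; last by rewrite mulr0.
by rewrite -im mdeg1 in m1.
Qed.

Lemma lform_inj n : injective (@lform n).
Proof. by move=> u v uv; apply/rowP => j; rewrite -!lform_mcoeffU uv. Qed.

End LinSubst.

(** * Krull dimension of ideals of linear forms *)

Section KrullDimension.
Variable K : fieldType.

Lemma prime_ideal_ker p q (M : 'M[K]_(p, q)) :
  prime_ideal (fun f => lin_subst M f = 0).
Proof.
split.
- split; first exact: raddf0.
    by move=> f g f0 g0; rewrite rmorphD /= f0 g0 addr0.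
  by move=> r f f0; rewrite rmorphM /= f0 mulr0.
- by rewrite rmorph1 => /eqP; rewrite oner_eq0.
- move=> f g; rewrite rmorphM /= => /eqP.
  by rewrite mulf_eq0 => /orP[] /eqP; [left | right].
Qed.

(** * Chains of primes, bounded by counting polynomials of bounded degree *)

Lemma prime_chain_leq n (I : {mpoly K[n]} -> Prop) k k' :
  (k' <= k)%N -> prime_chain I k -> prime_chain I k'.
Proof.
move=> le_k [P [Pprime IP Pinc Pstrict]]; exists P; split=> // i lt_i.
- exact/Pprime/(leq_trans lt_i).
- exact/Pinc/(leq_trans lt_i).
- exact/Pstrict/(leq_trans lt_i).
Qed.

Definition indep_mod n (P : {mpoly K[n]} -> Prop) (T : finType)
    (b : T -> {mpoly K[n]}) :=
  forall c : T -> K, P (\sum_x c x *: b x) -> forall x, c x = 0.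

(* A relation modulo P loses its constant term in f modulo Q; as P is prime, the
   rest can be divided by f. *)
Lemma indep_mod_powers n (P Q : {mpoly K[n]} -> Prop) (T : finType)
    (b : T -> {mpoly K[n]}) f t :
    prime_ideal P -> is_ideal Q -> (forall h, P h -> Q h) -> Q f -> ~ P f ->
  indep_mod Q b -> indep_mod P (fun x : 'I_t * T => f ^+ x.1 * b x.2).
Proof.
move=> [idP _ Pprime] idQ PQ Qf nPf bQ c.
have -> : \sum_x c x *: (f ^+ x.1 * b x.2) =
    \sum_(e < t) f ^+ e * \sum_y c (e, y) *: b y.
  transitivity (\sum_x c (x.1, x.2) *: (f ^+ x.1 * b x.2)).
    by apply: eq_bigr => -[].
  rewrite -(pair_bigA _ (fun e y => c (e, y) *: (f ^+ e * b y))) /=.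
  apply: eq_bigr => e _; rewrite mulr_sumr.
  by apply: eq_bigr => y _; rewrite scalerAr.
suff tower : forall u (d : nat -> T -> K),
    P (\sum_(e < u) f ^+ e * \sum_y d e y *: b y) ->
    forall e y, (e < u)%N -> d e y = 0.
  (* Extending [c] by zero to all natural exponents lets the induction shift exponents freely. *)
  pose d e y := if insub e is Some e' then c (e', y) else 0.
  move=> Pc [e y]; have dE (e' : 'I_t) z : d e' z = c (e', z) by rewrite /d valK.
  rewrite -dE; apply: (tower t) => //; move: Pc; congr P.
  by apply: eq_bigr => e' _; congr (_ * _); apply: eq_bigr => z _; rewrite dE.
elim=> // u IHu d Pd.
have [_ QD QM] := idQ.
have tailE : \sum_(e < u.+1) f ^+ e * (\sum_y d e y *: b y) =
    \sum_y d 0%N y *: b y + f * \sum_(e < u) f ^+ e * \sum_y d e.+1 y *: b y.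
  rewrite big_ord_recl expr0 mul1r mulr_sumr; congr (_ + _).
  by apply: eq_bigr => e _; rewrite exprS mulrA.
rewrite tailE in Pd.
have d0 y : d 0%N y = 0.
  apply: bQ; rewrite -[X in Q X](addrK (f * \sum_(e < u) f ^+ e * \sum_y d e.+1 y *: b y)).
  apply: ideal_sub (PQ _ Pd) _ => //; rewrite mulrC; exact: QM.
move: Pd; rewrite big1 ?add0r => [/Pprime[//|Pd]|y _]; last by rewrite d0 scale0r.
by case=> [|e] y lt_e; [exact: d0 | apply: (IHu (fun e => d e.+1))].
Qed.

Lemma msize_mul_le n (f g : {mpoly K[n]}) : (msize (f * g) <= msize f + msize g)%N.
Proof.
have [->|f0] := eqVneq f 0; first by rewrite mul0r msize0.
have [->|g0] := eqVneq g 0; first by rewrite mulr0 msize0.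
by rewrite msizeM ?leq_pred.
Qed.

Lemma msize_exp_mul_le n (f g : {mpoly K[n]}) e t : (e <= t)%N ->
  (msize (f ^+ e * g) <= t * msize f + msize g)%N.
Proof.
elim: e t => [|e IHe] [|t] // le_e; first by rewrite expr0 mul1r.
  by rewrite expr0 mul1r leq_addl.
rewrite exprS -mulrA mulSn -addnA (leq_trans (msize_mul_le _ _)) //.
by rewrite leq_add2l; apply: IHe.
Qed.

(** Modulo the top prime the polynomial 1 is independent. Going down, each strict inclusion supplies
    an element whose first [t] powers multiply the family by [t]; [D] adds up the sizes of these
    elements. *)
Lemma prime_chain_indep n j (P : nat -> {mpoly K[n]} -> Prop) :
    (forall i, (i <= j)%N -> prime_ideal (P i)) ->
    (forall i, (i < j)%N -> forall f, P i f -> P i.+1 f) ->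
    (forall i, (i < j)%N -> exists f, P i.+1 f /\ ~ P i f) ->
  exists D, forall t, exists (T : finType) (b : T -> {mpoly K[n]}),
    [/\ #|T| = (t ^ j)%N, forall x, (msize (b x) <= t * D + 1)%N
      & indep_mod (P 0%N) b].
Proof.
elim: j P => [|j IHj] P Pprime Pinc Pstrict.
  exists 0%N => t; exists unit, (fun=> 1); split.
  - by rewrite card_unit expn0.
  - by move=> x; rewrite msize1 muln0.
  - move=> c Pc [].
    have [[_ _ PM] nP1 _] := Pprime 0%N isT.
    have [//|c0] := eqVneq (c tt) 0; case: nP1.
    have := PM (c tt)^-1%:MP _ Pc.
    rewrite (bigD1 tt) //= big1 => [|[]] //.
    by rewrite addr0 mul_mpolyC scalerA mulVf // scale1r.
have [|||D HD] := IHj (fun i => P i.+1).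
- by move=> i lt_i; apply: Pprime.
- by move=> i lt_i; apply: Pinc.
- by move=> i lt_i; apply: Pstrict.
have [f [P1f nP0f]] := Pstrict 0%N isT.
exists (msize f + D)%N => t; have [T [b [cardT sz_b ind_b]]] := HD t.
exists ('I_t * T)%type, (fun x : 'I_t * T => f ^+ x.1 * b x.2); split.
- by rewrite card_prod card_ord cardT expnS.
- move=> [e x] /=; apply: (leq_trans (msize_exp_mul_le _ _ (ltnW (ltn_ord e)))).
  by rewrite mulnDr -addnA leq_add2l.
- apply: (indep_mod_powers (Q := P 1%N)) => //.
  + exact: Pprime.
  + by have [] := Pprime 1%N isT.
  + exact: Pinc.
Qed.

(** The coefficient vectors are independent and involve only monomials of degree below [B], each of
    whose [n] exponents is below [B]. *)
Lemma indep_mod_card n (P : {mpoly K[n]} -> Prop) (T : finType)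
    (b : T -> {mpoly K[n]}) B :
    P 0 -> (forall x, (msize (b x) <= B)%N) -> indep_mod P b ->
  (#|T| <= B ^ n)%N.
Proof.
move=> P0 sz_b ind_b; set X : finType := 'X_{1..n < B}.
have leX : (#|X| <= B ^ n)%N.
  rewrite -[B in (B ^ _)%N]card_ord -[n in (_ ^ n)%N]card_ord -card_ffun.
  have lt_m (m : X) i : (val m i < B)%N.
    apply: leq_ltn_trans (bmdeg m); rewrite mdegE (bigD1 i) //=.
    exact: leq_addr.
  apply: (leq_card (fun m : X => [ffun i => Ordinal (lt_m m i)])) => m m' eq_m.
  apply/val_inj/mnmP => i.
  by have /ffunP/(_ i) := eq_m; rewrite !ffunE => /(congr1 val).
apply: leq_trans leX.
pose A := \matrix_(x < #|T|, m < #|X|) (b (enum_val x))@_(val (enum_val m)).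
suff /eqP <- : row_free A by exact: rank_leq_col.
rewrite -kermx_eq0; apply/eqP/row_matrixP => r; rewrite row0.
have : row r (kermx A) *m A = 0 by rewrite -row_mul mulmx_ker row0.
move: (row r (kermx A)) => u uA.
apply/rowP => x; rewrite [RHS]mxE -(enum_valK x).
move: (enum_val x); apply: (ind_b (fun y => u 0 (enum_rank y))).
suff -> : \sum_y u 0 (enum_rank y) *: b y = 0 by [].
apply/mpolyP => m; rewrite mcoeff0 linear_sum /=.
have [lt_m|le_m] := ltnP (mdeg m) B; last first.
  rewrite big1 // => y _; rewrite mcoeffZ (memN_msupp_eq0 (p := b y)) ?mulr0 //.
  by apply: msize_mdeg_ge; apply: leq_trans le_m.
move/rowP/(_ (enum_rank (BMultinom lt_m : X))): uA; rewrite mxE [RHS]mxE.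
apply: etrans.
rewrite (reindex (@enum_val T T)) /=; last exact/onW_bij/enum_val_bij.
by apply: eq_bigr => y _; rewrite mcoeffZ enum_valK mxE enum_rankK.
Qed.

Lemma prime_chain_mpoly_le n j (I : {mpoly K[n]} -> Prop) :
  prime_chain I j -> (j <= n)%N.
Proof.
case=> P [Pprime _ Pinc Pstrict]; rewrite leqNgt; apply/negP => lt_nj.
have [|||D HD] := @prime_chain_indep n n.+1 P.
- by move=> i le_i; apply: Pprime; apply: leq_trans lt_nj.
- by move=> i le_i; apply: Pinc; apply: leq_trans lt_nj.
- by move=> i le_i; apply: Pstrict; apply: leq_trans lt_nj.
(* Since this [t] exceeds [D.+1 ^ n], the size [t ^ n.+1] of the family exceeds [(t * D.+1) ^ n], a
   bound for the number of monomials. *)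
have [T [b [cardT sz_b ind_b]]] := HD ((D.+1) ^ n).+1.
set t := ((D.+1) ^ n).+1 in cardT sz_b ind_b.
have P0 : P 0%N 0 by have [[]] := Pprime 0%N isT.
have := indep_mod_card P0 sz_b ind_b; rewrite cardT leqNgt => /negP; apply.
have le_B : (t * D + 1 <= t * D.+1)%N by rewrite mulnS addnC leq_add2r.
apply: (@leq_ltn_trans ((t * D.+1) ^ n)%N).
  by case: (n) => // n'; rewrite leq_exp2r.
by rewrite expnMn expnSr ltn_pmul2l ?expn_gt0.
Qed.

(** Substituting by [S] and by [T] gives inverse isomorphisms between the quotient by the forms in
    the rows of [A] and a polynomial ring in [n - \rank A] variables. [S] is a column basis of the
    cokernel matrix and [T] a left inverse of it. *)
Lemma linear_parametrization s n (A : 'M[K]_(s, n)) :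
  exists (S : 'M_(n, n - \rank A)) (T : 'M_(n - \rank A, n)),
    [/\ A *m S = 0, T *m S = 1%:M & (1%:M - S *m T <= A)%MS].
Proof.
rewrite -mxrank_coker; set C := cokermx A.
have TS : pinvmx (col_base C) *m col_base C = 1%:M.
  by rewrite mulVpmx // col_base_full.
exists (col_base C), (pinvmx (col_base C)); split=> //.
  apply: (row_free_inj (row_base_free C)).
  by rewrite mul0mx -mulmxA mulmx_base mulmx_coker.
have ST0 : (1%:M - col_base C *m pinvmx (col_base C)) *m col_base C = 0.
  by rewrite mulmxBl mul1mx -mulmxA TS mulmx1 subrr.
rewrite submxE -/C; move: ST0; set M := 1%:M - _ => ST0.
by rewrite -(mulmx_base C) mulmxA ST0 mul0mx.
Qed.

Definition row_ideal s n (A : 'M[K]_(s, n)) :=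
  ideal_gen (fun f => exists i, f = lform (row i A)).

Lemma row_ideal_lform s n (A : 'M[K]_(s, n)) v :
  (v <= A)%MS -> row_ideal A (lform v).
Proof.
case/submxP=> u ->; rewrite mulmx_sum_row linear_sum; apply: ideal_sum.
  exact: ideal_gen_ideal.
move=> i _; rewrite /= linearZ /=; apply: ideal_scale; first exact: ideal_gen_ideal.
by apply: ideal_gen_mem; exists i.
Qed.

Lemma row_ideal_ker s n q (A : 'M[K]_(s, n)) (S : 'M_(n, q)) f :
  A *m S = 0 -> row_ideal A f -> lin_subst S f = 0.
Proof.
move=> AS; apply: (@ideal_gen_min _ _ _ (fun h => lin_subst S h = 0)); first by case: (prime_ideal_ker S).
by move=> _ [i ->]; rewrite lin_subst_lform -row_mul AS row0 linear0.
Qed.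

Lemma row_ideal_sub_lin_subst s n (A : 'M[K]_(s, n)) (M : 'M_n) f :
  (1%:M - M <= A)%MS -> row_ideal A (f - lin_subst M f).
Proof.
move=> MA; apply: sub_lin_subst_ideal => [|i]; first exact: ideal_gen_ideal.
by apply: row_ideal_lform; apply: submx_trans MA; apply: row_sub.
Qed.

(* The kernels of the substitutions killing the first i parameters form the
   chain. *)
Lemma row_ideal_prime_chain s n (A : 'M[K]_(s, n)) :
  prime_chain (row_ideal A) (n - \rank A).
Proof.
have [S [T [AS TS _]]] := linear_parametrization A.
set k := (n - \rank A)%N in S T AS TS *.
exists (fun i f => lin_subst (S *m copid_mx i) f = 0); split.
- by move=> i _; apply: prime_ideal_ker.
- by move=> f; apply: row_ideal_ker; rewrite mulmxA AS mul0mx.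
- move=> i lt_i f f0.
  have -> : S *m copid_mx i.+1 = S *m copid_mx i *m copid_mx i.+1.
    rewrite -mulmxA; congr (_ *m _); rewrite /copid_mx mulmxBl mul1mx mulmxBr mulmx1.
    by rewrite mul_pid_mx (minn_idPl (leqnSn i)) (minn_idPr (ltnW lt_i)) subrr subr0.
  by rewrite -lin_subst_comp f0 raddf0.
(* This form restricts to the parameter of index [i], which is killed at stage [i.+1] but not yet at
   stage [i]. *)
- move=> i lt_i; exists (lform (row (Ordinal lt_i) T)).
  rewrite !lin_subst_lform -!row_mul !mulmxA TS !mul1mx; split.
    rewrite -[RHS](linear0 (@lform K k)); congr lform; apply/rowP => j.
    by rewrite !mxE /= ltnSn andbT -val_eqE /= subrr.
  move/(congr1 (mcoeff U_(Ordinal lt_i))); rewrite lform_mcoeffU mcoeff0 !mxE.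
  by rewrite eqxx ltnn andbF subr0 => /eqP; rewrite oner_eq0.
Qed.

(** The chain is pulled back along [T]. Inclusions stay strict because substituting by [S] and then
    by [T] changes a polynomial only by an element of the row ideal, which lies in every prime of
    the chain. *)
Lemma row_ideal_prime_chain_le s n (A : 'M[K]_(s, n)) j :
  prime_chain (row_ideal A) j -> (j <= n - \rank A)%N.
Proof.
have [S [T [AS TS ST]]] := linear_parametrization A.
case=> P [Pprime AP Pinc Pstrict].
apply: (@prime_chain_mpoly_le _ _ (fun f => f = 0)).
have AST f : row_ideal A (f - lin_subst T (lin_subst S f)).
  by rewrite lin_subst_comp; apply: row_ideal_sub_lin_subst.
have Pmono f i : (i <= j)%N -> P 0%N f -> P i f.
  by elim: i => // i IHi lt_i P0f; apply: Pinc (IHi (ltnW lt_i) P0f).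
have PST i f : (i <= j)%N -> P i (lin_subst T (lin_subst S f)) <-> P i f.
  move=> le_i; have [idP _ _] := Pprime i le_i.
  have PA : P i (f - lin_subst T (lin_subst S f)) by apply: Pmono (AP _ (AST f)).
  split=> [Pf|Pf].
    by rewrite -[f](subrK (lin_subst T (lin_subst S f))); case: idP => _ PD _; apply: PD.
  by rewrite -[lin_subst T _](subKr f); apply: ideal_sub.
exists (fun i f => P i (lin_subst T f)); split.
- move=> i le_i; have [[P0 PD PM] nP1 Pp] := Pprime i le_i; split.
  + split=> [|f g Pf Pg|r f Pf]; first by rewrite raddf0.
      by rewrite rmorphD; apply: PD.
    by rewrite rmorphM; apply: PM.
  + by rewrite rmorph1.
  + by move=> f g; rewrite rmorphM; apply: Pp.
- by move=> _ ->; rewrite raddf0; have [[]] := Pprime 0%N isT.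
- by move=> i lt_i f; apply: Pinc.
- move=> i lt_i; have [f [Pf nPf]] := Pstrict i lt_i.
  by exists (lin_subst S f); rewrite !PST // ltnW.
Qed.

End KrullDimension.

(** * Initial forms *)

Section InitialForms.
Variables (K : fieldType) (R : realType) (n : nat).
Implicit Types (w : 'I_n -> R) (A : {set 'I_n}) (v : 'rV[K]_n).

Lemma wdegD w m1 m2 : wdeg w (m1 + m2)%MM = wdeg w m1 + wdeg w m2.
Proof.
rewrite /wdeg -big_split /=; apply: eq_bigr => i _.
by rewrite mnmDE natrD mulrDr.
Qed.

Lemma wdegU w j : wdeg w U_(j)%MM = w j.
Proof.
rewrite /wdeg (bigD1 j) //= mnm1E eqxx mulr1 big1 ?addr0 // => i ij.
by rewrite mnm1E eq_sym (negbTE ij) mulr0.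
Qed.

Lemma mcoeff_init_form w (f : {mpoly K[n]}) m :
  (init_form w f)@_m =
    if all (fun m' => wdeg w m <= wdeg w m') (msupp f) then f@_m else 0.
Proof.
rewrite /init_form linear_sum /=.
have [fm|nfm] := boolP (m \in msupp f); last first.
  rewrite (memN_msupp_eq0 nfm) if_same big_seq_cond big1 // => m' /andP[fm' _].
  rewrite mcoeffZ mcoeffX; case: eqP => [mm'|]; last by rewrite mulr0.
  by rewrite -mm' fm' in nfm.
rewrite big_mkcond (bigD1_seq m) ?msupp_uniq //= big1 ?addr0 => [|m' m'm].
  by case: ifP => // _; rewrite mcoeffZ mcoeffX eqxx mulr1.
by case: ifP => // _; rewrite mcoeffZ mcoeffX (negbTE m'm) mulr0.
Qed.

(** The index [A] of the relatively open cone that contains [w]. *)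
Definition minpos w : {set 'I_n} := [set i | [forall k, w i <= w k]].

Lemma minposP w i : reflect (is_min w i) (i \in minpos w).
Proof. by rewrite inE; apply: (iffP forallP). Qed.

Lemma minpos_open_cone w A : open_cone_W A w <-> minpos w = A.
Proof.
split=> [[Aw nAw]|<-].
  apply/setP => i; apply/minposP/idP => [wi|/Aw //].
  by apply/negPn/negP => /nAw.
by split=> i /minposP.
Qed.

Lemma minpos_neq0 w : (0 < n)%N -> minpos w != set0.
Proof.
move=> n_gt0; apply/set0Pn.
case: (arg_minP w (P := xpredT) (i0 := Ordinal n_gt0)) => // i _ wi.
by exists i; apply/minposP => k; apply: wi.
Qed.

Lemma minpos_eqw w i j : i \in minpos w -> j \in minpos w -> w i = w j.
Proof. by move=> /minposP wi /minposP wj; apply/eqP; rewrite eq_le wi wj. Qed.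

Lemma minpos_geP w i j : i \in minpos w -> (j \in minpos w) = (w j == w i).
Proof.
move=> wi; apply/idP/eqP => [wj|ji]; first exact: minpos_eqw.
by apply/minposP => k; rewrite ji; apply/minposP.
Qed.

Definition col_mask A : 'M[K]_n := diag_mx (\row_j (j \in A)%:R).

Lemma col_maskE p (M : 'M[K]_(p, n)) A i j :
  (M *m col_mask A) i j = M i j * (j \in A)%:R.
Proof. by rewrite mul_mx_diag !mxE. Qed.

(** As ['X_j] occurs in the form, its lowest weight is the minimum of [w], attained by exactly the
    terms in [minpos w]. *)
Lemma init_form_lform w v j : j \in minpos w -> v 0 j != 0 ->
  init_form w (lform v) = lform (v *m col_mask (minpos w)).
Proof.
move=> wj vj; apply/mpolyP => m; rewrite mcoeff_init_form.
have [/eqP/mdeg1P[k /eqP ->]|m1] := eqVneq (mdeg m) 1%N; last first.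
  have lf0 u : (lform u)@_m = 0 :> K.
    apply/eqP/negPn/negP => /lform_mcoeff_neq0[k mk].
    by rewrite mk mdeg1 in m1.
  by rewrite !lf0 if_same.
rewrite !lform_mcoeffU col_maskE wdegU.
have [wk|wk] := boolP (k \in minpos w).
  rewrite mulr1 ifT //; apply/allP => m'; rewrite mcoeff_msupp.
  by case/lform_mcoeff_neq0=> l ->; rewrite wdegU; apply/minposP.
rewrite mulr0 ifF //; apply/negbTE/allPn; exists U_(j)%MM.
  by rewrite mcoeff_msupp lform_mcoeffU.
rewrite wdegU; apply: contra wk => kj; apply/minposP => l.
exact: le_trans kj (minposP _ _ wj l).
Qed.

(** The weight-preserving part of the substitution [P]: the image of ['X_i] keeps only variables of
    the weight of ['X_i]. *)
Definition wpart w (P : 'M[K]_n) : 'M[K]_n :=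
  \matrix_(i, j) if w j == w i then P i j else 0.

(* p' is homogeneous of weight a and p - p' only has terms of weight above a *)
Definition lead_part w (a : R) (p p' : {mpoly K[n]}) :=
  forall m, (wdeg w m <= a -> p@_m = p'@_m) /\ (wdeg w m != a -> p'@_m = 0).

Lemma lead_part_lt w a p p' m : lead_part w a p p' -> wdeg w m < a ->
  p@_m = 0 /\ p'@_m = 0.
Proof.
move=> /(_ m)[pp' p'0] lt_m.
by rewrite pp' ?p'0 ?lt_eqF // ltW.
Qed.

Lemma lead_part1 w : lead_part w 0 1 1.
Proof.
move=> m; split=> //; rewrite mcoeff1; have [->|//] := eqVneq m 0%MM.
by rewrite /wdeg big1 ?eqxx // => i _; rewrite mnm0E mulr0.
Qed.

(** In total weight at most [a + b], a product of terms either has a factor below its own bound,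
    where both coefficients vanish, or attains both bounds. *)
Lemma lead_partM w a b p p' q q' :
  lead_part w a p p' -> lead_part w b q q' -> lead_part w (a + b) (p * q) (p' * q').
Proof.
move=> pp' qq' m; rewrite !mcoeffM; split=> [le_m|ne_m].
  apply: eq_bigr => k /eqP mk; rewrite mk wdegD in le_m.
  have [lt_a|le_a] := ltP (wdeg w k.1) a.
    by have [-> ->] := lead_part_lt pp' lt_a; rewrite !mul0r.
  have [lt_b|le_b] := ltP (wdeg w k.2) b.
    by have [-> ->] := lead_part_lt qq' lt_b; rewrite !mulr0.
  have le_ka : wdeg w k.1 <= a.
    by rewrite -(lerD2r b) (le_trans _ le_m) // lerD2l.
  have le_kb : wdeg w k.2 <= b.
    by rewrite -(lerD2l a) (le_trans _ le_m) // lerD2r.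
  by rewrite (pp' _).1 // (qq' _).1.
rewrite big1 // => k /eqP mk.
have [ka|ka] := eqVneq (wdeg w k.1) a; last by rewrite (pp' _).2 // mul0r.
have [kb|kb] := eqVneq (wdeg w k.2) b; last by rewrite (qq' _).2 // mulr0.
by rewrite mk wdegD ka kb eqxx in ne_m.
Qed.

Lemma lead_partX w a p p' k :
  lead_part w a p p' -> lead_part w (a * k%:R) (p ^+ k) (p' ^+ k).
Proof.
move=> pp'; elim: k => [|k IHk]; first by rewrite mulr0; apply: lead_part1.
by rewrite !exprS -natr1 mulrDr mulr1 addrC; apply: lead_partM.
Qed.

Lemma lead_part_lform w (P : 'M[K]_n) i : (forall j, P i j != 0 -> w i <= w j) ->
  lead_part w (w i) (lform (row i P)) (lform (row i (wpart w P))).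
Proof.
move=> wP m; have [/eqP/mdeg1P[k /eqP ->]|m1] := eqVneq (mdeg m) 1%N; last first.
  have lf0 u : (lform u)@_m = 0 :> K.
    apply/eqP/negPn/negP => /lform_mcoeff_neq0[k mk].
    by rewrite mk mdeg1 in m1.
  by rewrite !lf0.
rewrite !lform_mcoeffU !mxE wdegU; split=> [le_k|/negbTE -> //].
case: eqP => // ne_k; have [//|/wP le_i] := eqVneq (P i k) 0.
by case: ne_k; apply/le_anti; rewrite le_k.
Qed.

Lemma lead_part_Xm w (P : 'M[K]_n) m : (forall i j, P i j != 0 -> w i <= w j) ->
  lead_part w (wdeg w m) (lin_subst P 'X_[m]) (lin_subst (wpart w P) 'X_[m]).
Proof.
move=> wP; rewrite !lin_substXm /wdeg.
apply: (big_ind3 (fun p a p' => lead_part w a p p')) => [|*|i _].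
- exact: lead_part1.
- exact: lead_partM.
- exact: (lead_partX (m i) (lead_part_lform (wP i))).
Qed.

Lemma lin_subst_init_form w (P : 'M[K]_n) (f : {mpoly K[n]}) :
    (forall i j, P i j != 0 -> w i <= w j) ->
  lin_subst P f = 0 -> lin_subst (wpart w P) (init_form w f) = 0.
Proof.
move=> wP Pf; pose Q m := all (fun m' => wdeg w m <= wdeg w m') (msupp f).
have -> : init_form w f = \sum_(m <- msupp f | Q m) f@_m *: 'X_[m] by [].
rewrite linear_sum /=.
under eq_bigr => m _ do rewrite linearZ /=.
have [/hasP[m0 fm0 Qm0]|/hasPn noQ] := boolP (has Q (msupp f)); last first.
  by rewrite big_seq_cond big1 // => m /andP[/noQ/negP nQm /nQm].
have Qw m : m \in msupp f -> Q m = (wdeg w m == wdeg w m0).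
  move=> fm; apply/idP/eqP => [Qm|mm0].
    by apply/le_anti; rewrite (allP Qm) // (allP Qm0).
  by apply/allP => m' fm'; rewrite mm0 (allP Qm0).
apply/mpolyP => l; rewrite mcoeff0 linear_sum /=.
have [wl|wl] := eqVneq (wdeg w l) (wdeg w m0); last first.
  rewrite big_seq_cond big1 // => m /andP[fm]; rewrite Qw // => /eqP wm.
  by rewrite mcoeffZ (lead_part_Xm m wP l).2 ?mulr0 // wm.
(* In lowest weight, terms of [f] of larger weight contribute nothing to [lin_subst P f], and the
   others contribute through [wpart w P]. *)
have := congr1 (mcoeff l) Pf; rewrite lin_substE mcoeff0 linear_sum /=.
apply: etrans; rewrite big_seq_cond [RHS]big_seq [RHS](bigID Q) /= [X in _ + X]big1 ?addr0.
  apply: eq_bigr => m /andP[fm Qm]; rewrite !mcoeffZ (lead_part_Xm m wP l).1 //.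
  by rewrite wl (allP Qm0).
move=> m /andP[fm nQm]; rewrite mcoeffZ (lead_part_Xm m wP l).1 ?wl ?(allP Qm0) //.
by rewrite (lead_part_Xm m wP l).2 ?mulr0 // wl eq_sym -Qw.
Qed.

End InitialForms.

(** * Uniform linear ideals *)

Lemma card_inj_into (T : finType) d (A : {set T}) : (d <= #|A|)%N ->
  exists f : 'I_d -> T, injective f /\ forall a, f a \in A.
Proof.
move=> le_d; exists (fun a => enum_val (widen_ord le_d a)); split=> [a b|a].
  by move/enum_val_inj => /(congr1 val) /= /val_inj.
by rewrite /= enum_valP.
Qed.

Lemma card_inj_onto (T : finType) d (A : {set T}) : (#|A| <= d <= #|T|)%N ->
  exists f : 'I_d -> T, injective f /\ A \subset f @: 'I_d.
Proof.
case/andP=> le_Ad le_dT; pose s := take (d - #|A|) (enum (~: A)).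
have sC x : x \in s -> x \notin A by move/mem_take; rewrite mem_enum inE.
have cardC : #|A :|: [set x in s]| = d.
  rewrite cardsU (_ : A :&: _ = set0) ?cards0 ?subn0; last first.
    by apply/setP => x; rewrite !inE; apply/andP => -[Ax /sC]; rewrite Ax.
  rewrite cardsE (card_uniqP _) ?take_uniq ?enum_uniq // size_takel ?subnKC //.
  by rewrite -cardE [leqRHS]cardsCs setCK leq_sub2r.
have [f [f_inj fC]] : exists f : 'I_d -> T, injective f /\
    forall a, f a \in A :|: [set x in s] by apply: card_inj_into; rewrite cardC.
exists f; split=> //; suff -> : f @: 'I_d = A :|: [set x in s] by apply: subsetUl.
apply/eqP; rewrite eqEcard cardC card_imset // card_ord leqnn andbT.
by apply/subsetP => _ /imsetP[a _ ->].
Qed.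

Lemma colsub_mul (K : fieldType) n p q r (M : 'M[K]_(p, q)) (M' : 'M[K]_(q, n)) (f : 'I_r -> 'I_n) :
  colsub f (M *m M') = M *m colsub f M'.
Proof. by apply/matrixP => i j; rewrite !mxE; apply: eq_bigr => k _; rewrite !mxE. Qed.

Section UniformLinearIdeal.
Variables (K : fieldType) (R : realType) (n d : nat) (N : 'M[K]_(d, n)).
Variable J : {mpoly K[n]} -> Prop.
Hypothesis d_gt0 : (0 < d)%N.
Hypothesis le_dn : (d <= n)%N.
Hypothesis uniformN : forall f : 'I_d -> 'I_n, injective f ->
  \det (colsub f N) != 0.
(** [J] is pinned between the linear forms of a row space and the kernels of the substitutions
    annihilating them; no generators have to be carried through the coordinate change. *)
Hypothesis JN : forall u, J (lform (u *m N)).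
Hypothesis Jker : forall P : 'M[K]_n, N *m P = 0 ->
  forall h, J h -> lin_subst P h = 0.
Implicit Types (w : 'I_n -> R) (A : {set 'I_n}) (f : 'I_d -> 'I_n).

(** * Solving the linear equations for [d] of the variables *)

Lemma uniform_unit f : injective f -> colsub f N \in unitmx.
Proof. by move=> f_inj; rewrite unitmxE unitfE uniformN. Qed.

Lemma uniform_vanish u A : (d <= #|A|)%N ->
  (forall j, j \in A -> (u *m N) 0 j = 0) -> u = 0 :> 'rV_d.
Proof.
case/card_inj_into=> f [/uniform_unit Uf fA] uA.
rewrite -[u](mulmxK Uf) -colsub_mul (_ : colsub f _ = 0) ?mul0mx //.
by apply/rowP => a; rewrite !mxE -[RHS](uA _ (fA a)) mxE.
Qed.

Definition selection f : 'M[K]_(n, d) := \matrix_(i, a) (i == f a)%:R.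

(* Row f a of sol f is the combination of the rows of N with coefficient 1 at
   f a and 0 at the other f b, so that 1 - sol f solves the linear equations for
   the variables x_(f a). *)
Definition sol f : 'M[K]_n :=
  selection f *m (invmx (colsub f N) *m N).

(** The weight-preserving part of [1%:M - sol f] for weights minimal exactly on [A], if [f] takes
    values in [A]; only [A] enters, not the weight. *)
Definition init_subst f A : 'M[K]_n := 1%:M - sol f *m col_mask K A.

Lemma sub1solE f i j : (1%:M - sol f) i j = (i == j)%:R - sol f i j.
Proof. by rewrite mxE [X in _ + X]mxE [X in X - _]mxE. Qed.

Lemma init_substE f A i j :
  init_subst f A i j = (i == j)%:R - sol f i j * (j \in A)%:R.
Proof. by rewrite mxE [X in _ + X]mxE col_maskE [X in X - _]mxE. Qed.

Lemma row_sol f i : exists u, row i (sol f) = u *m N.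
Proof.
exists (row i (selection f) *m invmx (colsub f N)).
by rewrite /sol row_mul mulmxA.
Qed.

Lemma sol_f f a b : injective f -> sol f (f a) (f b) = (a == b)%:R.
Proof.
move=> f_inj; have -> : sol f (f a) (f b) = colsub f (sol f) (f a) b.
  by rewrite [RHS]mxE.
rewrite /sol !colsub_mul mulVmx ?uniform_unit // mulmx1 mxE.
by rewrite (inj_eq f_inj).
Qed.

Lemma sol0 f A i j : (forall a, f a \in A) -> i \notin A -> sol f i j = 0.
Proof.
move=> fA nAi; rewrite mxE big1 // => a _; rewrite mxE.
by case: eqP => [ia|]; rewrite ?mul0r //; rewrite ia fA in nAi.
Qed.

Lemma mul_sol f : injective f -> N *m (1%:M - sol f) = 0.
Proof.
move=> f_inj; rewrite mulmxBr mulmx1 /sol mulmxA.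
have -> : N *m selection f = colsub f N.
  apply/matrixP => i a; rewrite !mxE (bigD1 (f a)) //= mxE eqxx mulr1 big1 ?addr0 //.
  by move=> j ja; rewrite mxE (negbTE ja) mulr0.
by rewrite mulKVmx ?uniform_unit ?subrr.
Qed.

(** For [i] in [minpos w], equal weight means lying in [minpos w]; the other rows of [sol f] vanish,
    so there both sides are rows of the identity. *)
Lemma wpart_sol w f : (forall a, f a \in minpos w) ->
  wpart w (1%:M - sol f) = init_subst f (minpos w).
Proof.
move=> fw; apply/matrixP => i j; rewrite mxE sub1solE init_substE.
have [wi|nwi] := boolP (i \in minpos w).
  rewrite (minpos_geP _ wi); case: eqP => ji; first by rewrite mulr1.
  by rewrite mulr0 subr0; case: eqP => // ij; rewrite ij in ji.
rewrite (sol0 _ fw) // mul0r subr0.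
by have [<-|] := eqVneq i j; rewrite ?eqxx // if_same.
Qed.

(** [1%:M - sol f] alters only variables of minimal weight, so it never lowers weights and initial
    forms of [J] are killed by its weight-preserving part. *)
Lemma init_ideal_ker w f h : injective f -> (forall a, f a \in minpos w) ->
  init_ideal w J h -> lin_subst (init_subst f (minpos w)) h = 0.
Proof.
move=> f_inj fw; apply: (@ideal_gen_min _ _ _
  (fun h => lin_subst (init_subst f (minpos w)) h = 0)).
  by case: (prime_ideal_ker (init_subst f (minpos w))).
move=> _ [p [Jp ->]]; rewrite -wpart_sol //; apply: lin_subst_init_form.
  move=> i j; have [/minposP wi _|nwi] := boolP (i \in minpos w); first exact: wi.
  rewrite sub1solE (sol0 _ fw) // subr0.
  by have [<-|] := eqVneq i j; rewrite ?lexx // eqxx.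
by apply: Jker => //; apply: mul_sol.
Qed.

(** It suffices to treat variables. The difference is then a row of [sol f] cut down to [minpos w]:
    either zero or the initial form of a linear form of [J]. Hence the kernel lies in the initial
    ideal. *)
Lemma init_ideal_sub w f h : (forall a, f a \in minpos w) ->
  init_ideal w J (h - lin_subst (init_subst f (minpos w)) h).
Proof.
move=> fw; have idJ : is_ideal (init_ideal w J) by apply: ideal_gen_ideal.
apply: sub_lin_subst_ideal => // i; rewrite opprB addrC subrK row_mul.
have [u ->] := row_sol f i.
have [-> | ] := eqVneq (u *m N *m col_mask K (minpos w)) 0.
  by rewrite linear0; case: idJ.
case/rV0Pn=> j; rewrite col_maskE; have [wj|_] := boolP (j \in minpos w); last first.
  by rewrite mulr0 eqxx.
rewrite mulr1 => uj; rewrite -(init_form_lform wj uj).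
by apply: ideal_gen_mem; exists (lform (u *m N)).
Qed.

Lemma init_ideal_minpos w w' : minpos w = minpos w' -> (d <= #|minpos w|)%N ->
  ideal_eq (init_ideal w J) (init_ideal w' J).
Proof.
have half (v v' : 'I_n -> R) : minpos v = minpos v' -> (d <= #|minpos v|)%N ->
    forall h, init_ideal v J h -> init_ideal v' J h.
  move=> vv' /card_inj_into[f [f_inj fv]] h /(init_ideal_ker f_inj fv) h0.
  by rewrite -[h]subr0 -h0 vv'; apply: init_ideal_sub; rewrite -vv'.
by move=> ww' le_d h; split; apply: half; rewrite -?ww'.
Qed.

(** If the row vanished, [i] would lie in [A] and row [i] of [sol f] would be zero on the rest of
    [A]. That leaves at least [d] zeros, so this combination of rows of [N] is zero, yet its entry
    at [i] is 1. *)
Lemma row_init_subst_neq0 f A i :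
    injective f -> (forall a, f a \in A) -> (d < #|A|)%N ->
  row i (init_subst f A) != 0.
Proof.
move=> f_inj fA lt_d; apply/eqP => row0.
have solE j : j \in A -> sol f i j = (i == j)%:R.
  move=> Aj; move/rowP/(_ j): row0.
  rewrite mxE init_substE Aj mulr1 [RHS]mxE => /eqP.
  by rewrite subr_eq0 eq_sym => /eqP.
have Ai : i \in A.
  apply/negPn/negP => nAi; move/rowP/(_ i): row0.
  rewrite mxE init_substE (negbTE nAi) mulr0 subr0 mxE eqxx.
  by move/eqP; rewrite oner_eq0.
have [u solu] := row_sol f i.
have u0 : u = 0.
  apply: (@uniform_vanish u (A :\ i)) => [|j].
    by move: lt_d; rewrite (cardsD1 i) Ai.
  by case/setD1P=> ji Aj; rewrite -solu mxE solE // eq_sym (negbTE ji).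
move/rowP/(_ i): solu; rewrite u0 mul0mx mxE solE // eqxx mxE => /eqP.
by rewrite oner_eq0.
Qed.

Lemma init_subst_monomial f A c m :
    injective f -> (forall a, f a \in A) -> (d < #|A|)%N -> c != 0 ->
  lin_subst (init_subst f A) (c *: 'X_[m]) != 0.
Proof.
move=> f_inj fA lt_d c0; rewrite linearZ /= scaler_eq0 negb_or c0 lin_substXm.
apply/prodf_neq0 => i _; apply: expf_neq0; rewrite -(linear0 (@lform K n)).
by rewrite (inj_eq (@lform_inj _ _)); apply: row_init_subst_neq0.
Qed.

(** * Tropical points and Groebner classes in terms of [minpos] *)

Lemma trop_large w : (d < #|minpos w|)%N -> trop J w.
Proof.
move=> lt_d h Jh [c [m [c0 hm]]].
have [f [f_inj fw]] := card_inj_into (ltnW lt_d).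
have /eqP[] := init_subst_monomial m f_inj fw lt_d c0.
by rewrite -hm; apply: init_ideal_ker => //; apply: ideal_gen_mem; exists h.
Qed.

(** When the [d] solved variables include all those of minimal weight, the row of [sol f] at such an
    [i] has ['X_i] as its only term of minimal weight. *)
Lemma small_minpos_monomial w : (#|minpos w| <= d)%N ->
  exists h i, J h /\ init_form w h = 'X_i.
Proof.
move=> le_wd; have n_gt0 : (0 < n)%N by apply: leq_trans le_dn.
have /set0Pn[i wi] := minpos_neq0 w n_gt0.
have [|f [f_inj sub_wf]] := @card_inj_onto _ d (minpos w).
  by rewrite le_wd card_ord.
have [u solu] := row_sol f i.
exists (lform (u *m N)), i; split; first exact: JN.
have /imsetP[a _ ia] := subsetP sub_wf i wi.
have solE j : j \in minpos w -> (u *m N) 0 j = (i == j)%:R.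
  move/(subsetP sub_wf) => /imsetP[b _ ->].
  by rewrite -solu mxE ia sol_f // (inj_eq f_inj).
rewrite (init_form_lform (j := i)) ?solE ?eqxx ?oner_eq0 // -lformX.
congr lform; apply/rowP => j; rewrite col_maskE [RHS]mxE [RHS]mxE.
have [wj|nwj] := boolP (j \in minpos w); first by rewrite mulr1 solE.
by rewrite mulr0; case: eqP => // ij; rewrite -ij wi in nwj.
Qed.

Lemma trop_minpos w : trop J w <-> (d < #|minpos w|)%N.
Proof.
split=> [Tw|]; last exact: trop_large.
rewrite ltnNge; apply/negP => /small_minpos_monomial[h [i [Jh hi]]].
by apply: (Tw h Jh); rewrite hi; exists 1, U_(i)%MM; rewrite oner_eq0 scale1r.
Qed.

(** For [j] in [minpos w'] but not in [minpos w], a form of [J] with coefficient 1 at ['X_j] has an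
    initial form for [w'] containing ['X_j]. Column [j] of the substitution attached to [w] is a
    unit vector, so that coefficient survives and the form is not in the kernel. *)
Lemma init_ideal_minpos_sub w w' : (d < #|minpos w|)%N ->
  ideal_eq (init_ideal w J) (init_ideal w' J) -> minpos w' \subset minpos w.
Proof.
move=> lt_d ww'; apply/subsetP => j w'j; apply/negPn/negP => nwj.
have [f [f_inj fw]] := card_inj_into (ltnW lt_d).
have [|g [g_inj /subsetP/(_ j)]] := @card_inj_onto _ d [set j].
  by rewrite cards1 d_gt0 card_ord.
rewrite inE eqxx => /(_ isT)/imsetP[a _ ja]; have [u solu] := row_sol g j.
have uj : (u *m N) 0 j = 1 by rewrite -solu mxE ja sol_f // eqxx.
have : init_ideal w J (lform (u *m N *m col_mask K (minpos w'))).
  apply/ww'; rewrite -(init_form_lform w'j) ?uj ?oner_eq0 //.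
  by apply: ideal_gen_mem; exists (lform (u *m N)).
move/(init_ideal_ker f_inj fw); rewrite lin_subst_lform -(linear0 (@lform K n)).
move/lform_inj/rowP/(_ j)/eqP; rewrite mxE (bigD1 j) //= big1 => [|i ij].
  rewrite addr0 col_maskE w'j init_substE (negbTE nwj) eqxx uj mulr0 subr0 !mulr1.
  by rewrite mxE oner_eq0.
by rewrite init_substE (negbTE nwj) mulr0 subr0 (negbTE ij) mulr0.
Qed.

Lemma groeb_equiv_minpos w w' : (d < #|minpos w|)%N ->
  groeb_equiv J w w' <-> minpos w' = minpos w.
Proof.
move=> lt_d; split=> [ww'|ww']; last first.
  by apply: init_ideal_minpos; rewrite ?ww' // ltnW.
have w'w : ideal_eq (init_ideal w' J) (init_ideal w J).
  by move=> h; apply: iff_sym.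
apply/eqP; rewrite eqEsubset !init_ideal_minpos_sub //.
(* The reverse inclusion needs [minpos w'] to be large too: otherwise its initial ideal contains a
   variable, whereas that of [w] contains no monomial. *)
rewrite ltnNge; apply/negP => /small_minpos_monomial[h [i [Jh hi]]].
have [f [f_inj fw]] := card_inj_into (ltnW lt_d).
have /eqP[] := init_subst_monomial U_(i)%MM f_inj fw lt_d (oner_neq0 K).
rewrite scale1r; apply: init_ideal_ker => //; apply/ww'.
by apply: ideal_gen_mem; exists h.
Qed.

Lemma uniform_fan_eq m : (m + d)%N = n -> fan_eq (trop_cell (R := R) J) (@Wnm_cell n R m).
Proof.
move=> mdn C; split=> [[w [/trop_minpos lt_d Cw]]|[A [A0 leA CA]]].
  exists (minpos w); split.
  - by rewrite -card_gt0; apply: leq_trans lt_d.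
  - by move: lt_d; rewrite -(ltn_add2l m) mdn.
  - by move=> w'; rewrite Cw minpos_open_cone groeb_equiv_minpos.
(* A point of the relatively open cone of [A]: weight 0 on [A] and 1 elsewhere. *)
pose w i : R := (i \notin A)%:R.
have wA : minpos w = A.
  have [j Aj] := set0Pn _ A0.
  apply/setP => i; apply/minposP/idP => [/(_ j)|Ai k]; rewrite /w.
    by rewrite Aj lern0 eqb0 negbK.
  by rewrite Ai ler0n.
have lt_d : (d < #|minpos w|)%N by rewrite wA -(ltn_add2l m) mdn.
exists w; split; first exact/trop_minpos.
by move=> w'; rewrite CA minpos_open_cone groeb_equiv_minpos // wA.
Qed.

End UniformLinearIdeal.

(** * Generic coordinates *)

Lemma linear_forms_row_ideal (K : fieldType) n (I : {mpoly K[n]} -> Prop) :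
  gen_by_linear_forms I ->
  exists s (A : 'M[K]_(s, n)), ideal_eq I (row_ideal A).
Proof.
case=> s [lin_s Is].
pose A := \matrix_(i < size s, j < n) (nth 0 s i)@_U_(j).
have rowA (i : 'I_(size s)) : lform (row i A) = nth 0 s i.
  have [c sc] := lin_s _ (mem_nth 0 (ltn_ord i)).
  have -> : nth 0 s i = lform (\row_j c j).
    by rewrite sc; apply: eq_bigr => j _; rewrite mxE.
  congr lform; apply/rowP => j; rewrite !mxE sc -[LHS]/(_@__).
  have -> : \sum_(k < n) c k *: 'X_k = lform (\row_k c k).
    by apply: eq_bigr => k _; rewrite mxE.
  by rewrite lform_mcoeffU mxE.
exists (size s), A => f; rewrite Is; split; apply: ideal_gen_min.
- exact: ideal_gen_ideal.
- move=> g /(nthP 0)[i lt_i <-]; apply: ideal_gen_mem.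
  by exists (Ordinal lt_i); rewrite rowA.
- exact: ideal_gen_ideal.
- by move=> _ [i ->]; rewrite rowA; apply: ideal_gen_mem; apply: mem_nth.
Qed.

Lemma prime_chain_ideal_eq (K : fieldType) n (I J : {mpoly K[n]} -> Prop) k :
  ideal_eq I J -> prime_chain I k -> prime_chain J k.
Proof.
move=> IJ [P [Pprime IP Pinc Pstrict]]; exists P; split=> // f Jf.
by apply: IP; apply/IJ.
Qed.

Lemma krull_dim_row_ideal (K : fieldType) n s (A : 'M[K]_(s, n)) m :
  krull_dim_quot (row_ideal A) m -> (m + \rank A)%N = n.
Proof.
case=> chain_m nchain; suff -> : m = (n - \rank A)%N by rewrite subnK ?rank_leq_col.
apply/eqP; rewrite eqn_leq row_ideal_prime_chain_le //= leqNgt; apply/negP => lt_m.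
by apply: nchain; apply: prime_chain_leq lt_m (row_ideal_prime_chain A).
Qed.

Section GenericCoordinates.
Variable K : fieldType.

Definition uniform_mx d n (N : 'M[K]_(d, n)) :=
  forall f : 'I_d -> 'I_n, injective f -> \det (colsub f N) != 0.

(** Any [d] distinct columns form a square Vandermonde matrix, whose nodes are distinct integers and
    stay distinct in characteristic 0. *)
Lemma uniform_Vandermonde d n : [pchar K] =i pred0 ->
  uniform_mx (@Vandermonde K d n (\row_j (j : nat)%:R)).
Proof.
move=> /pcharf0P K0 f f_inj.
have natr_inj (i j : nat) : (i%:R == j%:R :> K) = (i == j).
  wlog le_ij : i j / (i <= j)%N.
    move=> H; case/orP: (leq_total i j) => [/H //|/H eq_ji].
    by rewrite eq_sym eq_ji eq_sym.
  by rewrite eq_sym -subr_eq0 -natrB // K0 subn_eq0 eqn_leq le_ij.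
have -> : colsub f (Vandermonde d (\row_j (j : nat)%:R)) =
    Vandermonde d (\row_a (f a : nat)%:R) :> 'M[K]_d.
  by apply/matrixP => i a; rewrite !mxE.
rewrite det_Vandermonde; apply/prodf_neq0 => i _; apply/prodf_neq0 => j lt_ij.
rewrite !mxE subr_eq0 natr_inj; apply: contraTneq lt_ij => /val_inj/f_inj ->.
by rewrite ltnn.
Qed.

Lemma uniform_row_free d n (N : 'M[K]_(d, n)) :
  (d <= n)%N -> uniform_mx N -> row_free N.
Proof.
move=> le_dn unifN; have f_inj : injective (widen_ord le_dn).
  by move=> a b /(congr1 val) /= /val_inj.
have Uf : colsub (widen_ord le_dn) N \in unitmx by rewrite unitmxE unitfE unifN.
apply/row_freeP; exists (colsub (widen_ord le_dn) 1%:M *m invmx (colsub (widen_ord le_dn) N)).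
by rewrite mulmxA -colsub_mul mulmx1 mulmxV.
Qed.

(* GL_n acts transitively on the subspaces of a given dimension. *)
Lemma exists_uniform_translate s n (A : 'M[K]_(s, n)) : [pchar K] =i pred0 ->
  exists2 g, g \in unitmx & uniform_mx (row_base A *m g).
Proof.
move=> K0; pose V := Vandermonde (\rank A) (\row_(j < n) (j : nat)%:R) : 'M[K]_(_, n).
have unifV : uniform_mx V by apply: uniform_Vandermonde.
have rankV : \rank V = \rank A.
  by apply/eqP/uniform_row_free => //; apply: rank_leq_col.
(* This [g] carries [row_base A] to a basis of the row space of [V], so the maximal minors of [V]
   are those of [row_base A *m g] times one fixed determinant. *)
exists (invmx (row_ebase A) *m row_ebase V).
  by rewrite unitmx_mul unitmx_inv !row_ebase_unit.
move=> f f_inj; have := unifV f f_inj.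
rewrite -{1}(mulmx_ebase V) rankV -mulmxA colsub_mul det_mulmx mulf_eq0 negb_or.
by rewrite /row_base -mulmxA mulKVmx ?row_ebase_unit // => /andP[].
Qed.

(** The maximal minors of [N] times a matrix of indeterminates, multiplied together so that a single
    polynomial in the entries of [g] cuts out the open set. *)
Definition generic_minors d n (N : 'M[K]_(d, n)) : {mpoly K[n * n]} :=
  \prod_(f : {ffun 'I_d -> 'I_n} | injectiveb f)
    \det (colsub f (map_mx (@mpolyC (n * n) K) N *m \matrix_(i, j) 'X_(mxvec_index i j))).

Lemma generic_minors_eval d n (N : 'M[K]_(d, n)) g :
  (generic_minors N).@[fun k => mxvec g 0 k] != 0 <-> uniform_mx (N *m g).
Proof.
set v := fun k => mxvec g 0 k.
have evalE (f : 'I_d -> 'I_n) :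
    (\det (colsub f (map_mx (@mpolyC (n * n) K) N *m
       \matrix_(i, j) 'X_(mxvec_index i j)))).@[v] = \det (colsub f (N *m g)).
  rewrite -det_map_mx; congr (\det _); apply/matrixP => i a; rewrite !mxE rmorph_sum.
  by apply: eq_bigr => k _; rewrite rmorphM /= !mxE mevalC mevalXU /v mxvecE.
rewrite /generic_minors rmorph_prod; split=> [/prodf_neq0 minors_neq0 f f_inj|unifN].
  have := minors_neq0 (finfun f); rewrite /= evalE.
  have -> : colsub (finfun f) (N *m g) = colsub f (N *m g).
    by apply/matrixP => i a; rewrite [LHS]mxE [RHS]mxE ffunE.
  by apply; apply/injectiveP => a b; rewrite !ffunE; apply: f_inj.
by apply/prodf_neq0 => f /injectiveP f_inj; rewrite /= evalE unifN.
Qed.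

Lemma zariski_open_uniform d n (N : 'M[K]_(d, n)) :
  zariski_open_GL (fun g => g \in unitmx /\ uniform_mx (N *m g)).
Proof.
split=> [g []//|]; exists (fun h => h = generic_minors N) => g Ug; split.
  by case=> _ /generic_minors_eval neq0; exists (generic_minors N).
by case=> _ [-> /generic_minors_eval].
Qed.

End GenericCoordinates.

Theorem theorem9p7 (K : closedFieldType) (hK : [pchar K] =i pred0)
  (R : realType) (n m : nat) (I : {mpoly K[n]} -> Prop)
  (hgen : gen_by_linear_forms I) (hnz : exists f, I f /\ f != 0)
  (hdim : krull_dim_quot I m) :
  generic_trop_is I (@Wnm_cell n R m).
Proof.
have [s [A IA]] := linear_forms_row_ideal hgen.
have mAn : (m + \rank A)%N = n.
  apply: krull_dim_row_ideal; case: hdim => chain_m nchain; split.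
    exact: prime_chain_ideal_eq chain_m.
  by move=> chain; apply: nchain; apply: prime_chain_ideal_eq chain => f; apply: iff_sym.
have A_gt0 : (0 < \rank A)%N.
  (* If [A] were zero, even the identity substitution would annihilate [I], contradicting the
     nonzero element. *)
  rewrite lt0n mxrank_eq0; apply/eqP => A0.
  have [f [/IA If /eqP[]]] := hnz; rewrite -[f]lin_subst1.
  by apply: row_ideal_ker If; rewrite A0 mul0mx.
exists (fun g => g \in unitmx /\ uniform_mx (row_base A *m g)); split.
- exact: zariski_open_uniform.
- by have [g Ug unif_g] := exists_uniform_translate A hK; exists g.
move=> g [Ug unif_g]; apply: (uniform_fan_eq A_gt0 (rank_leq_col A) unif_g) => //.
  move=> u; exists (lform (u *m row_base A)).
  rewrite gactE lin_subst_lform mulmxA; split=> //; apply/IA/row_ideal_lform.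
  by apply: submx_trans (submxMl _ _) _; rewrite eq_row_base.
(* Acting by [g] and then substituting by [P] is substitution by [g *m P], which annihilates the
   rows of [A]. *)
move=> P NP _ [f [/IA If ->]]; rewrite gactE lin_subst_comp.
apply: row_ideal_ker If; rewrite -{1}(mulmx_base A) -mulmxA.
by rewrite (mulmxA (row_base A)) NP mulmx0.
Qed.
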